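(* Let $p$ be a prime number, let $v$ be a positive real number and let $d$ be a positive integer. For $k\in\mathbb{Z}$ and $i\in\{1,\ldots,p^d-1\}$ with base-$p$ expansion $i=\sum_{j=0}^{d-1}i_{j+1}p^j$, $0\leq i_j\leq p-1$, let $\mathrm{B}_{ki}\subset(\mathbb{Q}_p)^d$ be the $d$-dimensional $p$-adic ball $$\mathrm{B}_{ki}=\mathrm{B}\big((i_1p^{-k-1},i_2p^{-k-1},\ldots,i_dp^{-k-1}),\,p^k\big).$$ The balls $\mathrm{B}_{ki}$ are pairwise disjoint, and the following statements hold: (1) There exists a noncompact $d$-dimensional $p$-adic analytic manifold $\mathcal{M}_{d,v}\subset(\mathbb{Q}_p)^d$ with $p$-adic volume $v$, defined as follows: if $v=\sum_{k=-\infty}^m a_kp^{dk}$ is the expression of $v$ in base $p^d$ with infinitely many nonzero digits (for example, $1$ in base $9$ becomes $0.888\ldots$), then $$\mathcal{M}_{d,v}=\bigcup_{k=-\infty}^{m}\bigcup_{i=1}^{a_k}\mathrm{B}_{ki}\subset(\mathbb{Q}_p)^d.$$ (2) If, in addition, $v$ is rational and its denominator is a power of $p$, then there also exists a compact $d$-dimensional $p$-adic analytic manifold $\mathcal{M}'_{d,v}\subset(\mathbb{Q}_p)^d$ with $p$-adic volume $v$, defined as follows: if $v=\sum_{k=\ell}^m a_kp^{dk}$ is the expression of $v$ in base $p^d$ with finitely many nonzero digits (which exists because $v$ is rational and its denominator is a power of $p$), then $$\mathcal{M}'_{d,v}=\bigcup_{k=\ell}^{m}\bigcup_{i=1}^{a_k}\mathrm{B}_{ki}\subset(\mathbb{Q}_p)^d.$$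 Moreover, when $d=2n$ is even, endow $\mathcal{M}_{d,v}$ and $\mathcal{M}'_{d,v}$ with the standard symplectic form $\sum_{i=1}^n\mathrm{d}x_i\wedge\mathrm{d}\xi_i$. If in the definition of $\mathcal{M}_{d,v}$ (respectively $\mathcal{M}'_{d,v}$) the balls are replaced by other pairwise disjoint balls in $(\mathbb{Q}_p)^d$ of the same radii, the resulting $p$-adic analytic manifold (with the standard symplectic form) is symplectomorphic to the original one.
   Context: $(\mathbb{Q}_p)^d$ carries the norm $\|x\|_p=\max_i|x_i|_p$; for $r$ an integer power of $p$, $\mathrm{B}(x,r)=\{y\in(\mathbb{Q}_p)^d:\|y-x\|_p\leq r\}$. Digits in base $p^d$ satisfy $0\leq a_k\leq p^d-1$. The $p$-adic volume of an open subset of $(\mathbb{Q}_p)^d$ is its measure for the standard volume form $\mathrm{d}x_1\wedge\cdots\wedge\mathrm{d}x_d$, i.e. the Haar measure normalized so that $(\mathbb{Z}_p)^d$ has measure $1$; thus a ball of radius $p^k$ has volume $p^{dk}$. A function between open subsets of $p$-adic spaces is $p$-adic analytic if its domain is a union of balls on each of which it is given by a convergent $p$-adic power series; open subsets of $(\mathbb{Q}_p)^d$ are $p$-adic analytic manifolds. Two $p$-adic analytic symplectic manifolds $(M,\omega)$, $(M',\omega')$ are symplectomorphic if there is a bi-analytic bijection $\psi:M\to M'$ with $\psi^*\omega'=\omega$. *)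

(* Defs.v *)
From HB Require Import structures.
From mathcomp Require Import all_boot all_order all_algebra fraction finmap.
From mathcomp Require Import cyclic.
From mathcomp Require Import all_classical all_reals all_analysis.
From mathcomp.analysis.showcase Require summability.

Set Implicit Arguments.
Unset Strict Implicit.
Unset Printing Implicit Defensive.

Import Order.TTheory GRing.Theory Num.Theory.
Import numFieldNormedType.Exports.

Local Open Scope classical_set_scope.
Local Open Scope ring_scope.

(* Z_p is the inverse limit of the Z/p^n: [x n] is the residue modulo [p ^ n],
   taken in [0, p ^ n). *)
Definition coherent (p : nat) (x : nat -> nat) : Prop :=
  forall n, (x n.+1 %% p ^ n)%N = x n.

Record padic_int (p : nat) (p_pr : prime p) : Type := PadicInt {
  res : nat -> nat ;
  res_coherent : coherent p res }.

Section PadicInt.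
Variables (p : nat) (p_pr : prime p).
Local Notation Zp := (padic_int p_pr).
Implicit Types x y z : Zp.

HB.instance Definition _ := gen_eqMixin Zp.
HB.instance Definition _ := gen_choiceMixin Zp.

Lemma padic_intP x y : (forall n, res x n = res y n) -> x = y.
Proof.
case: x y => [x cx] [y cy] /= /funext xy; case: _ / xy cy => cy.
by rewrite (Prop_irrelevance cx cy).
Qed.

Lemma modn_expS m n : (m %% p ^ n.+1 = m %[mod p ^ n])%N.
Proof. by rewrite modn_dvdm// dvdn_exp2l. Qed.

Lemma res_mod x n : (res x n %% p ^ n)%N = res x n.
Proof. by rewrite -(res_coherent x) modn_mod. Qed.

Lemma resS x n : (res x n.+1 = res x n %[mod p ^ n])%N.
Proof. by rewrite (res_coherent x) res_mod. Qed.

(* The p-adic integer with residues [f n], for [f] compatible modulo powers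
   of [p] but not necessarily reduced. *)
Lemma coherent_mod (f : nat -> nat) :
  (forall n, f n.+1 = f n %[mod p ^ n])%N ->
  coherent p (fun n => f n %% p ^ n)%N.
Proof. by move=> fE n; rewrite modn_expS fE. Qed.

Definition padic_of (f : nat -> nat)
  (fE : (forall n, f n.+1 = f n %[mod p ^ n])%N) : Zp :=
  PadicInt p_pr (coherent_mod fE).

Lemma const_compat m : (forall n, m = m %[mod p ^ n])%N. Proof. by []. Qed.

Lemma add_compat x y :
  (forall n, res x n.+1 + res y n.+1 = res x n + res y n %[mod p ^ n])%N.
Proof. by move=> n; rewrite -modnDm !resS modnDm. Qed.

Lemma mul_compat x y :
  (forall n, res x n.+1 * res y n.+1 = res x n * res y n %[mod p ^ n])%N.
Proof. by move=> n; rewrite -modnMm !resS modnMm. Qed.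

Lemma opp_compat x :
  (forall n, (p ^ n.+1).-1 * res x n.+1 = (p ^ n).-1 * res x n %[mod p ^ n])%N.
Proof.
have E (m y : nat) : (0 < m -> m.-1 * y + y = m * y)%N.
  by move=> m0; rewrite -mulSnr prednK.
have p0 k : (0 < p ^ k)%N by rewrite expn_gt0 prime_gt0.
move=> n; apply/eqP; rewrite -(eqn_modDr (res x n)) (E _ _ (p0 n)) modnMr.
rewrite -[X in X == _](modnDmr _ (res x n)) -resS modnDmr E//.
by rewrite expnS mulnAC modnMl.
Qed.

Definition zp_const m : Zp := padic_of (const_compat m).
Definition zp_add x y : Zp := padic_of (add_compat x y).
Definition zp_mul x y : Zp := padic_of (mul_compat x y).
Definition zp_opp x : Zp := padic_of (opp_compat x).

Lemma zp_addA : associative zp_add.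
Proof. by move=> x y z; apply: padic_intP => n /=; rewrite modnDml modnDmr addnA. Qed.

Lemma zp_addC : commutative zp_add.
Proof. by move=> x y; apply: padic_intP => n /=; rewrite addnC. Qed.

Lemma zp_add0 : left_id (zp_const 0) zp_add.
Proof. by move=> x; apply: padic_intP => n /=; rewrite mod0n add0n res_mod. Qed.

Lemma zp_addN : left_inverse (zp_const 0) zp_opp zp_add.
Proof.
move=> x; apply: padic_intP => n /=.
by rewrite modnDml -mulSnr prednK ?expn_gt0 ?prime_gt0// modnMr mod0n.
Qed.

HB.instance Definition _ :=
  GRing.isZmodule.Build Zp zp_addA zp_addC zp_add0 zp_addN.

Lemma zp_mulA : associative zp_mul.
Proof. by move=> x y z; apply: padic_intP => n /=; rewrite modnMml modnMmr mulnA. Qed.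

Lemma zp_mulC : commutative zp_mul.
Proof. by move=> x y; apply: padic_intP => n /=; rewrite mulnC. Qed.

Lemma zp_mul1 : left_id (zp_const 1) zp_mul.
Proof. by move=> x; apply: padic_intP => n /=; rewrite modnMml mul1n res_mod. Qed.

Lemma zp_mulDl : left_distributive zp_mul zp_add.
Proof.
by move=> x y z; apply: padic_intP => n /=; rewrite modnMml modnDm mulnDl.
Qed.

Lemma zp_1neq0 : zp_const 1 != 0 :> Zp.
Proof.
apply/eqP => /(congr1 (fun x => res x 1)) /=.
by rewrite expn1 mod0n modn_small ?prime_gt1.
Qed.

HB.instance Definition _ := GRing.Zmodule_isComNzRing.Build Zp
  zp_mulA zp_mulC zp_mul1 zp_mulDl zp_1neq0.

Lemma res0 n : res (0 : Zp) n = 0%N. Proof. exact: mod0n. Qed.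

Lemma resD x y n : res (x + y) n = ((res x n + res y n) %% p ^ n)%N.
Proof. by []. Qed.

Lemma resM x y n : res (x * y) n = ((res x n * res y n) %% p ^ n)%N.
Proof. by []. Qed.

Lemma res1 n : res (1 : Zp) n = (1 %% p ^ n)%N. Proof. by []. Qed.

Lemma res_nat m n : res (m%:R : Zp) n = (m %% p ^ n)%N.
Proof.
elim: m => [|m IHm]; first by rewrite res0 mod0n.
by rewrite -natr1 resD IHm res1 modnDm addn1.
Qed.

Lemma res_trunc x n k : (res x (n + k) %% p ^ n)%N = res x n.
Proof.
elim: k => [|k IHk]; first by rewrite addn0 res_mod.
rewrite -IHk addnS -(res_coherent x (n + k)) modn_dvdm//.
by rewrite dvdn_exp2l// leq_addr.
Qed.

(* A p-adic integer is invertible iff it does not vanish modulo [p]. *)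

Definition zp_unit : {pred Zp} := fun x => res x 1 != 0%N.

Lemma zp_unit_coprime x n : x \in zp_unit -> coprime (res x n) (p ^ n).
Proof.
case: n => [|n] xu; first by rewrite expn0 coprimen1.
rewrite coprime_pexpr// coprime_sym prime_coprime//.
apply: contra xu => /eqP px; apply/eqP.
by rewrite -(res_trunc x 1 n) expn1 add1n.
Qed.

Definition res_inv x n : nat := (res x n ^ (totient (p ^ n)).-1)%N.

Lemma res_invP x n :
  x \in zp_unit -> (res_inv x n * res x n = 1 %[mod p ^ n])%N.
Proof.
move=> xu; rewrite /res_inv mulnC -expnS prednK.
  exact: Euler_exp_totient (zp_unit_coprime n xu).
by rewrite totient_gt0 expn_gt0 prime_gt0.
Qed.

Lemma inv_compat x : x \in zp_unit ->
  (forall n, res_inv x n.+1 = res_inv x n %[mod p ^ n])%N.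
Proof.
move=> xu n; set a := res_inv x n.+1; set b := res_inv x n.
have ax : (a * res x n = 1 %[mod p ^ n])%N.
  rewrite -modnMmr -resS modnMmr -(modn_expS (a * _)) res_invP//.
  by rewrite modn_expS.
rewrite -[a]muln1 -modnMmr -(res_invP n xu) -/b modnMmr [(b * _)%N]mulnC mulnA.
by rewrite -modnMml ax modnMml mul1n.
Qed.

Definition zp_inv x : Zp :=
  if pselect (x \in zp_unit) is left xu then padic_of (inv_compat xu) else x.

Lemma zp_mulV : {in zp_unit, left_inverse 1 zp_inv *%R}.
Proof.
move=> x xu; rewrite /zp_inv; case: pselect => // xu'.
by apply: padic_intP => n; rewrite resM res1 /= modnMml res_invP.
Qed.

Lemma zp_unitPl x y : y * x = 1 -> x \in zp_unit.
Proof.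
move=> /(congr1 (fun z => res z 1)); rewrite resM res1 expn1 => yx.
apply/eqP => x0; move: yx; rewrite x0 muln0 mod0n modn_small//.
exact: prime_gt1.
Qed.

Lemma zp_inv_out : {in [predC zp_unit], zp_inv =1 id}.
Proof. by move=> x /negP xu; rewrite /zp_inv; case: pselect. Qed.

HB.instance Definition _ := GRing.ComNzRing_hasMulInverse.Build Zp
  zp_mulV zp_unitPl zp_inv_out.

Lemma zp_unitE x : (x \is a GRing.unit) = (res x 1 != 0%N). Proof. by []. Qed.

Lemma zp_div x : res x 1 = 0%N -> exists y, x = p%:R * y.
Proof.
move=> x0; have dvd n : (p %| res x n.+1)%N.
  by apply/eqP; rewrite -x0 -[in RHS](res_trunc x 1 n) expn1 add1n.
have c n : (res x n.+2 %/ p = res x n.+1 %/ p %[mod p ^ n])%N.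
  apply/eqP; rewrite -(eqn_pmul2l (prime_gt0 p_pr)) !muln_modr -expnS.
  by rewrite !(mulnC p) !divnK// resS.
exists (padic_of c); apply: padic_intP => n.
by rewrite resM res_nat /= modnMm mulnC divnK// (res_coherent x).
Qed.

Lemma zp_decomp x : x != 0 ->
  exists k, exists2 u, u \is a GRing.unit & x = p%:R ^+ k * u.
Proof.
move=> x0; have [n xn0] : exists n, res x n.+1 != 0%N.
  apply: contra_notP (negP x0) => /forallNP h.
  apply/eqP/padic_intP => n; rewrite res0 -(res_trunc x n 1) addn1.
  by have /negP/negPn/eqP -> := h n; rewrite mod0n.
elim: n x xn0 {x0} => [|n IHn] x xn0.
  by exists 0%N; exists x; rewrite ?expr0 ?mul1r.
have [x10|x10] := eqVneq (res x 1) 0%N; last first.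
  by exists 0%N; exists x; rewrite ?expr0 ?mul1r.
have [y xE] := zp_div x10; have [|k [u uu yE]] := IHn y.
  apply: contra xn0 => /eqP y0; rewrite xE resM res_nat modnMml expnS.
  by rewrite -muln_modr res_coherent y0 muln0.
by exists k.+1; exists u; rewrite // xE yE exprS mulrA.
Qed.

Lemma zp_exp_neq0 k : p%:R ^+ k != 0 :> Zp.
Proof.
apply/eqP => /(congr1 (fun z => res z k.+1)); rewrite -natrX res_nat res0.
rewrite modn_small ?ltn_exp2l ?prime_gt1//.
by apply/eqP; rewrite -lt0n expn_gt0 prime_gt0.
Qed.

Lemma zp_idomain x y : x * y = 0 -> (x == 0) || (y == 0).
Proof.
move=> xy; apply: contra_eqT xy; rewrite negb_or => /andP[].
move=> /zp_decomp[k [u uu ->]] /zp_decomp[l [w wu ->]].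
rewrite mulrACA -exprD; apply/negP => /eqP h.
have /eqP := zp_exp_neq0 (k + l); apply.
by apply: (mulIr (_ : u * w \is a GRing.unit)); rewrite ?unitrM ?uu ?mul0r.
Qed.

HB.instance Definition _ := GRing.ComUnitRing_isIntegral.Build Zp zp_idomain.

End PadicInt.

Definition padic (p : nat) (p_pr : prime p) : Type := {fraction (padic_int p_pr)}.

Section Padic.
Variables (p : nat) (p_pr : prime p).
Local Notation Zp := (padic_int p_pr).
Local Notation Qp := (padic p_pr).
Implicit Types x y z : Qp.

HB.instance Definition _ := GRing.Field.on Qp.
HB.instance Definition _ := isPointed.Build Qp 0.

Definition zp2qp (a : Zp) : Qp := tofrac a.

HB.instance Definition _ := GRing.RMorphism.copy zp2qp (@tofrac Zp).

(* The valuation of [x != 0] is the unique [m] such that [x = p ^ m * u] with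
   [u] a unit of Z_p. *)
Definition padic_val x : int :=
  xget 0 [set m : int | exists2 u : Zp, u \is a GRing.unit &
                        x = p%:R ^ m * zp2qp u].

(* The distance derived from this norm takes values in [rat], so that the
   topology of Q_p does not depend on a model of the real numbers. *)
Definition padic_norm x : rat := if x == 0 then 0 else p%:R ^ (- padic_val x).

Lemma zp2qp_inj : injective zp2qp. Proof. by move=> a b /eqP; rewrite tofrac_eq => /eqP. Qed.

Lemma padicp_neq0 : p%:R != 0 :> Qp.
Proof.
by rewrite -(rmorph_nat zp2qp) -(rmorph0 zp2qp) (inj_eq zp2qp_inj) -[p%:R]expr1 zp_exp_neq0.
Qed.

Lemma zp2qp_unit_neq0 (u : Zp) : u \is a GRing.unit -> zp2qp u != 0.
Proof.
move=> uu; rewrite -(rmorph0 zp2qp) (inj_eq zp2qp_inj).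
by apply: contraTneq uu => ->; rewrite unitr0.
Qed.

Lemma padic_frac x : exists a b : Zp, b != 0 /\ x = zp2qp a / zp2qp b.
Proof.
elim/quotW: x => r; exists (frac r).1, (frac r).2; split.
  exact: denom_ratioP.
rewrite /zp2qp; unlock tofrac.
rewrite -[X in _ = _ * X]FracField.pi_inv -[RHS]FracField.pi_mul.
congr (\pi _)%qT; rewrite /FracField.mulf /FracField.invf.
rewrite !numden_Ratio ?oner_neq0 ?denom_ratioP//.
by rewrite mulr1 mul1r Ratio_numden.
Qed.

Lemma padic_decomp x : x != 0 ->
  exists m : int, exists2 u : Zp, u \is a GRing.unit & x = p%:R ^ m * zp2qp u.
Proof.
have [a [b [b0 ->]]] := padic_frac x => ab0.
have a0 : a != 0 by apply: contraNneq ab0 => ->; rewrite rmorph0 mul0r.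
have [[k [u uu ->]] [l [w wu ->]]] := (zp_decomp a0, zp_decomp b0).
exists (k%:Z - l%:Z); exists (u / w); first by rewrite unitrM uu unitrV.
rewrite expfzDr ?padicp_neq0// -exprnN -exprnP.
rewrite !rmorphM !rmorphXn rmorph_nat rmorphV// invfM.
by rewrite mulrACA.
Qed.

Lemma zp2qp_unit_exp (u w : Zp) (m : int) : u \is a GRing.unit ->
  w \is a GRing.unit -> zp2qp u = p%:R ^ m * zp2qp w -> m = 0.
Proof.
move=> uu wu.
have key (k : nat) (a b : Zp) : b \is a GRing.unit ->
    zp2qp b = p%:R ^+ k * zp2qp a -> k = 0%N.
  case: k => // k bu; rewrite -(rmorph_nat zp2qp) -rmorphXn -rmorphM.
  move=> /zp2qp_inj bE; move: bu; rewrite bE zp_unitE exprS -mulrA.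
  by rewrite resM res_nat expn1 modnn mul0n mod0n eqxx.
case: m => k; first by move=> /(key _ _ _ uu) ->.
move=> uE; suff: k.+1 = 0%N by [].
apply: (key _ u w) => //; rewrite uE NegzE -exprnN mulrA divff ?mul1r//.
by rewrite expf_neq0 ?padicp_neq0.
Qed.

Lemma padic_norm_decomp (m : int) (u : Zp) : u \is a GRing.unit ->
  padic_norm (p%:R ^ m * zp2qp u) = p%:R ^ (- m).
Proof.
move=> uu; rewrite /padic_norm mulf_eq0 (negPf (zp2qp_unit_neq0 uu)) orbF.
rewrite expfz_eq0 (negPf padicp_neq0) andbF; congr (_ ^ (- _)).
rewrite /padic_val; case: xgetP => [n _ [w wu]|/(_ m) []]; last by exists u.
move=> /(congr1 (fun z => p%:R ^ (- m) * z)).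
rewrite !mulrA -!expfzDr ?padicp_neq0// addNr expr0z mul1r.
move=> /(zp2qp_unit_exp uu wu) /eqP.
by rewrite addrC subr_eq0 => /eqP.
Qed.

Lemma padic_norm0 : padic_norm 0 = 0.
Proof. by rewrite /padic_norm eqxx. Qed.

Lemma padic_norm_ge0 x : 0 <= padic_norm x.
Proof. by rewrite /padic_norm; case: eqP => // _; rewrite exprz_ge0. Qed.

Lemma padic_norm_eq0 x : padic_norm x = 0 -> x = 0.
Proof.
rewrite /padic_norm; case: eqP => // _ /eqP.
by rewrite expfz_eq0 pnatr_eq0 gtn_eqF ?prime_gt0// andbF.
Qed.

Lemma padic_normN x : padic_norm (- x) = padic_norm x.
Proof.
have [->|x0] := eqVneq x 0; first by rewrite oppr0.
have [m [u uu ->]] := padic_decomp x0.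
by rewrite -mulrN -rmorphN !padic_norm_decomp// unitrN.
Qed.

Lemma padic_normM x y : padic_norm (x * y) = padic_norm x * padic_norm y.
Proof.
have [->|x0] := eqVneq x 0; first by rewrite mul0r padic_norm0 mul0r.
have [->|y0] := eqVneq y 0; first by rewrite mulr0 padic_norm0 mulr0.
have [m [u uu ->]] := padic_decomp x0; have [n [w wu ->]] := padic_decomp y0.
rewrite mulrACA -expfzDr ?padicp_neq0// -rmorphM !padic_norm_decomp//.
  by rewrite opprD expfzDr// pnatr_eq0 gtn_eqF ?prime_gt0.
by rewrite unitrM uu.
Qed.

Lemma padic_norm_zp (a : Zp) : padic_norm (zp2qp a) <= 1.
Proof.
have [->|a0] := eqVneq a 0; first by rewrite rmorph0 padic_norm0.
have [k [u uu ->]] := zp_decomp a0.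
rewrite rmorphM rmorphXn rmorph_nat exprnP padic_norm_decomp//.
by rewrite -exprnN invf_le1 ?exprn_gt0 ?ltr0n ?prime_gt0// exprn_ege1// ler1n prime_gt0.
Qed.

Lemma padic_normD x y :
  padic_norm (x + y) <= Num.max (padic_norm x) (padic_norm y).
Proof.
wlog xy : x y / padic_norm y <= padic_norm x.
  move=> h; have /orP[|] := le_total (padic_norm y) (padic_norm x); first exact: h.
  by rewrite addrC maxC; exact: h.
rewrite (max_idPl xy).
have [x0|x0] := eqVneq x 0.
  by move: xy; rewrite x0 padic_norm0 => ?; rewrite add0r.
have [y0|y0] := eqVneq y 0; first by rewrite y0 addr0.
have [m [u uu xE]] := padic_decomp x0; have [n [w wu yE]] := padic_decomp y0.
have mn : m <= n.
  move: xy; rewrite xE yE !padic_norm_decomp// ler_eXz2l ?lerN2//.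
  by rewrite ltr1n prime_gt1.
have -> : x + y = x * zp2qp (1 + u^-1 * (p%:R ^+ `|n - m| * w)).
  have nm : (`|n - m|%N%:Z = n - m)%R by rewrite gez0_abs// subr_ge0.
  rewrite rmorphD rmorph1 mulrDr mulr1; congr (_ + _).
  rewrite {1}xE -mulrA -rmorphM mulrA mulrV// mul1r rmorphM rmorphXn.
  by rewrite rmorph_nat exprnP nm mulrA -expfzDr ?padicp_neq0// addrC subrK.
by rewrite padic_normM ler_piMr ?padic_norm_ge0// padic_norm_zp.
Qed.

Definition padic_dist x y : rat := padic_norm (x - y).

Lemma padic_distxx x : padic_dist x x = 0.
Proof. by rewrite /padic_dist subrr padic_norm0. Qed.

Lemma padic_dist_eq0 x y : padic_dist x y = 0 -> x = y.
Proof. by move/padic_norm_eq0/eqP; rewrite subr_eq0 => /eqP. Qed.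

Lemma padic_distC x y : padic_dist x y = padic_dist y x.
Proof. by rewrite /padic_dist -padic_normN opprB. Qed.

Lemma padic_dist_triangle y x z :
  padic_dist x z <= padic_dist x y + padic_dist y z.
Proof.
rewrite /padic_dist -(subrKA y) (le_trans (padic_normD _ _))//.
by rewrite ge_max lerDl lerDr !padic_norm_ge0.
Qed.

HB.instance Definition _ := isMetric.Build rat Qp
  padic_distxx padic_dist_eq0 padic_distC padic_dist_triangle.

End Padic.

Section PadicSpace.
Variables (p : nat) (p_pr : prime p).
Local Notation Qp := (padic p_pr).

Definition padic_vnorm (d : nat) (x : 'rV[Qp]_d) : rat :=
  \big[Num.max/0]_(i < d) padic_norm (x 0 i).

(* Unlike the balls of the pseudometric structure, these are closed balls. *)
Definition padic_ball (d : nat) (x : 'rV[Qp]_d) (r : rat) : set 'rV[Qp]_d :=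
  [set y | padic_vnorm (y - x) <= r].

Definition padic_monomial (d : nat) (x : 'rV[Qp]_d) (I : {ffun 'I_d -> nat}) : Qp :=
  \prod_(i < d) x 0 i ^+ I i.

(* [f] is given on [B] by the convergent power series
   [\sum_I (y - c) ^ I *: a I] centered at [c], indexed by the multi-indices
   [I]; the sum is the limit of the finite partial sums along the directed set
   of finite sets of multi-indices. *)
Definition power_series_on (d d' : nat) (B : set 'rV[Qp]_d) (c : 'rV[Qp]_d)
    (a : {ffun 'I_d -> nat} -> 'rV[Qp]_d') (f : 'rV[Qp]_d -> 'rV[Qp]_d') : Prop :=
  forall y, B y ->
    summability.partial_sum (fun I => padic_monomial (y - c) I *: a I)
      @ summability.totally --> f y.

Definition padic_analytic (d d' : nat) (U : set 'rV[Qp]_d)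
    (f : 'rV[Qp]_d -> 'rV[Qp]_d') : Prop :=
  forall x, U x -> exists (c : 'rV[Qp]_d) (k : int),
    [/\ padic_ball c (p%:R ^ k) x, padic_ball c (p%:R ^ k) `<=` U
      & exists a, power_series_on (padic_ball c (p%:R ^ k)) c a f].

(* The matrix [J] acts on row vectors on the right, so that it is the transpose
   of the usual Jacobian matrix. *)
Definition is_padic_diff (d d' : nat) (f : 'rV[Qp]_d -> 'rV[Qp]_d')
    (x : 'rV[Qp]_d) (J : 'M[Qp]_(d, d')) : Prop :=
  forall e : rat, 0 < e -> \forall h \near (0 : 'rV[Qp]_d),
    padic_vnorm (f (x + h) - f x - h *m J) <= e * padic_vnorm h.

(* A 2-form on a subset of (Q_p)^d is given by its Gram matrices:
   [w x i j] is the value at [x] on the [i]-th and [j]-th coordinate fields. *)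
Definition two_form (d : nat) : Type := 'rV[Qp]_d -> 'M[Qp]_d.

Definition pullback_on (d d' : nat) (M : set 'rV[Qp]_d)
    (f : 'rV[Qp]_d -> 'rV[Qp]_d') (w' : two_form d') (w : two_form d) : Prop :=
  forall x, M x -> exists J,
    is_padic_diff f x J /\ J *m w' (f x) *m J^T = w x.

(* The form [dx_1 /\ dxi_1 + ... + dx_n /\ dxi_n] in the coordinates
   [(x_1, xi_1, ..., x_n, xi_n)]; only meaningful for [d] even. *)
Definition standard_symplectic (d : nat) : two_form d := fun=>
  \matrix_(i, j) (if ~~ odd i && (j == i.+1 :> nat) then 1
                  else if ~~ odd j && (i == j.+1 :> nat) then -1 else 0).

(* [f] and [g] matter only on [M] and [M'] respectively; these sets are open as
   soon as [f] and [g] are analytic on them. *)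
Definition symplectomorphic (d : nat) (M : set 'rV[Qp]_d) (w : two_form d)
    (M' : set 'rV[Qp]_d) (w' : two_form d) : Prop :=
  exists f g : 'rV[Qp]_d -> 'rV[Qp]_d,
    [/\ [/\ set_fun M M' f, set_fun M' M g,
            forall x, M x -> g (f x) = x & forall y, M' y -> f (g y) = y],
        padic_analytic M f, padic_analytic M' g & pullback_on M f w' w].

End PadicSpace.

Arguments standard_symplectic {p p_pr d} x.

Definition padic_borel (p : nat) (p_pr : prime p) (d : nat) :=
  g_sigma_algebraType (@open 'rV[padic p_pr]_d).

Definition normalized_haar (R : realType) (p : nat) (p_pr : prime p) (d : nat)
    (mu : {measure set (padic_borel p_pr d) -> \bar R}) : Prop :=
  [/\ forall (x : 'rV[padic p_pr]_d) (A : set (padic_borel p_pr d)),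
        measurable A -> mu [set x + y | y in A] = mu A
    & mu (padic_ball 0 1) = 1%E].

(* The normalized Haar measure is unique, so that quantifying over all of them
   amounts to evaluating it at [A]. *)
Definition has_padic_volume (R : realType) (p : nat) (p_pr : prime p) (d : nat)
    (A : set 'rV[padic p_pr]_d) (v : R) : Prop :=
  forall mu : {measure set (padic_borel p_pr d) -> \bar R},
    normalized_haar mu -> mu A = v%:E.

(* The digits at the positions above [m] are irrelevant. *)
Definition infinite_expansion (R : realType) (b : nat) (v : R) (m : int)
    (a : int -> nat) : Prop :=
  [/\ forall k : int, k <= m -> (a k <= b.-1)%N,
      infinite_set [set k : int | k <= m /\ a k != 0%N]
    & series (fun n => (a (m - n%:Z))%:R * b%:R ^ (m - n%:Z)) @ \oo --> v].

Definition finite_expansion (R : realType) (b : nat) (v : R) (l m : int)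
    (a : int -> nat) : Prop :=
  [/\ l <= m, forall k : int, l <= k <= m -> (a k <= b.-1)%N
    & v = \sum_(n < `|m - l|.+1) (a (l + n%:Z))%:R * b%:R ^ (l + n%:Z)].

(* The indices of the balls appearing for the digits [a] at the positions in
   [K]. *)
Definition ball_indices (K : set int) (a : int -> nat) : set (int * nat) :=
  [set ki | K ki.1 /\ (1 <= ki.2 <= a ki.1)%N].

(* [(i %/ p ^ j) %% p] is the [j]-th digit of [i] in base [p]. *)
Definition padic_center (p : nat) (p_pr : prime p) (d : nat) (ki : int * nat) :
    'rV[padic p_pr]_d :=
  \row_(j < d) (((ki.2 %/ p ^ j) %% p)%:R * p%:R ^ (- ki.1 - 1)).

Definition balls_of (p : nat) (p_pr : prime p) (d : nat)
    (c : int * nat -> 'rV[padic p_pr]_d) (ki : int * nat) :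
    set 'rV[padic p_pr]_d :=
  padic_ball (c ki) (p%:R ^ ki.1).

Definition ball_union (p : nat) (p_pr : prime p) (d : nat)
    (c : int * nat -> 'rV[padic p_pr]_d) (K : set int) (a : int -> nat) :
    set 'rV[padic p_pr]_d :=
  \bigcup_(ki in ball_indices K a) balls_of c ki.

Definition padic_manifold (p : nat) (p_pr : prime p) (d : nat) (K : set int)
    (a : int -> nat) : set 'rV[padic p_pr]_d :=
  ball_union (padic_center p_pr d) K a.

Arguments padic_manifold {p} p_pr d K a _.

(* Main.v *)
(* A ball of radius p ^ (k + 1) is the disjoint union of p ^ d translates of a
   ball of radius p ^ k, indexed by the digits of the coordinates; hence a Haar
   measure gives volume p ^ (d * k) to a ball of radius p ^ k, and the volume of
   a disjoint union of balls is read off the expansion of v. With infinitely many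
   balls the origin is in the closure but not in the union, while balls are
   compact because Z_p is an inverse limit of finite rings: an ultrafilter on Z_p
   selects one residue modulo each p ^ n. Moving each ball of one family onto the
   corresponding ball of another by a translation preserves any constant 2-form. *)
Require Import Defs.
From mathcomp Require Import all_boot all_order all_algebra finmap.
From mathcomp Require Import all_classical all_reals all_analysis.
From mathcomp.analysis.showcase Require summability.
From mathcomp Require Import ring zify.

Set Implicit Arguments.
Unset Strict Implicit.
Unset Printing Implicit Defensive.

Import Order.TTheory GRing.Theory Num.Theory.
Import numFieldNormedType.Exports.

Local Open Scope classical_set_scope.
Local Open Scope ring_scope.

(** * The norm of Q_p and the powers of [p] *)

Section Norm.
Variables (p : nat) (p_pr : prime p).
Local Notation Qp := (padic p_pr).
Implicit Types (x y : Qp) (k l : int).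

Lemma prime_expz_gt0 k : 0 < p%:R ^ k :> rat.
Proof. by rewrite exprz_gt0// ltr0n prime_gt0. Qed.

Lemma ler_prime_expz k l : (p%:R ^ k <= p%:R ^ l :> rat) = (k <= l).
Proof. by rewrite ler_eXz2l// ltr1n prime_gt1. Qed.

Lemma prime_expz_small (e : rat) : 0 < e -> exists k, p%:R ^ k < e.
Proof.
move=> e0; have [n en] : exists n : nat, e^-1 < n%:R.
  by exists (Num.truncn e^-1).+1; rewrite truncnS_gt.
exists (- n%:Z); rewrite -exprnN -[ltRHS]invrK ltf_pV2 ?posrE ?invr_gt0//.
  by rewrite (lt_trans en)// -natrX ltr_nat ltn_expl// prime_gt1.
by rewrite exprn_gt0// ltr0n prime_gt0.
Qed.

Lemma padic_norm_expz k : padic_norm (p%:R ^ k : Qp) = p%:R ^ (- k).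
Proof.
by rewrite -[p%:R ^ k]mulr1 -(rmorph1 (@zp2qp _ p_pr)) padic_norm_decomp ?unitr1.
Qed.

Lemma padic_norm_unit (u : padic_int p_pr) : u \is a GRing.unit ->
  padic_norm (zp2qp u) = 1.
Proof. by move=> uu; rewrite -[zp2qp u]mul1r -(expr0z p%:R) padic_norm_decomp. Qed.

(** Write a nonzero [x] as [p ^ m] times a unit: the bound on the norm forces [m >= 0]. *)
Lemma padic_norm_le1 x : padic_norm x <= 1 -> exists a, x = zp2qp a.
Proof.
have [->|x0] := eqVneq x 0; first by exists 0; rewrite rmorph0.
have [m [u uu ->]] := padic_decomp x0.
rewrite padic_norm_decomp// -[1](expr0z p%:R) ler_prime_expz oppr_le0.
case: m => // n _; exists (p%:R ^+ n * u).
by rewrite rmorphM rmorphXn rmorph_nat.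
Qed.

(** The difference of two distinct digits is nonzero modulo [p], hence a unit of Z_p. *)
Lemma padic_norm_digits (a b : nat) : (a < p)%N -> (b < p)%N -> a != b ->
  padic_norm (a%:R - b%:R : Qp) = 1.
Proof.
wlog ab : a b / (a < b)%N => [h ap bp ab|_ bp _].
  have [|ba] := ltnP a b; first by move=> ?; exact: h.
  by rewrite -padic_normN opprB h// 1?eq_sym// ltn_neqAle eq_sym ab.
rewrite -padic_normN opprB -natrB ?(ltnW ab)// -(rmorph_nat (@zp2qp _ p_pr)).
rewrite padic_norm_unit// zp_unitE res_nat expn1 modn_small; lia.
Qed.

End Norm.

(** * Ultrametric balls and the topology of (Q_p)^d *)

Section Balls.
Variables (p : nat) (p_pr : prime p) (d : nat).
Local Notation V := 'rV[padic p_pr]_d.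
Implicit Types (x y z : V) (r : rat) (k l : int).

Lemma vnorm_leP x r : 0 <= r ->
  reflect (forall i, padic_norm (x 0 i) <= r) (padic_vnorm x <= r).
Proof.
move=> r0; apply: (iffP idP) => [xr i|xr].
  by rewrite (le_trans _ xr)// /padic_vnorm le_bigmax.
by rewrite /padic_vnorm; apply/bigmax_leP; split.
Qed.

Lemma vnorm_ge0 x : 0 <= padic_vnorm x.
Proof. by rewrite /padic_vnorm bigmax_ge_id. Qed.

Lemma vnorm0 : padic_vnorm (0 : V) = 0.
Proof.
by apply/eqP; rewrite eq_le vnorm_ge0 andbT; apply/vnorm_leP => // i;
  rewrite mxE padic_norm0.
Qed.

Lemma vnormN x : padic_vnorm (- x) = padic_vnorm x.
Proof. by apply: eq_bigr => i _; rewrite mxE padic_normN. Qed.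

(** The ultrametric inequality; with a common bound [r], it makes the balls of a fixed radius the
    classes of an equivalence relation. *)
Lemma vnormD x y r :
  padic_vnorm x <= r -> padic_vnorm y <= r -> padic_vnorm (x + y) <= r.
Proof.
move=> xr yr; have r0 := le_trans (vnorm_ge0 x) xr.
apply/vnorm_leP => // i; rewrite mxE (le_trans (padic_normD _ _))// ge_max.
by move/vnorm_leP : xr => ->//; move/vnorm_leP : yr => ->.
Qed.

Lemma padic_ball_center x r : 0 <= r -> padic_ball x r x.
Proof. by move=> r0; rewrite /padic_ball/= subrr vnorm0. Qed.

Lemma padic_ball_sym x y r : padic_ball x r y -> padic_ball y r x.
Proof. by rewrite /padic_ball/= -vnormN opprB. Qed.

Lemma padic_ball_trans x y z r :
  padic_ball x r y -> padic_ball y r z -> padic_ball x r z.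
Proof.
by rewrite /padic_ball/= => xy yz; rewrite -(subrKA y z) vnormD.
Qed.

Lemma sub_padic_ball x r r' : r <= r' -> padic_ball x r `<=` padic_ball x r'.
Proof. by move=> rr' y /le_trans; exact. Qed.

Lemma padic_ball_shift (t x : V) r :
  [set t + y | y in padic_ball x r] = padic_ball (t + x) r.
Proof.
apply/seteqP; split => [_ [y yx <-]|y yx] /=.
  by rewrite /padic_ball/= opprD addrACA subrr add0r.
exists (y - t); last by rewrite addrC subrK.
by rewrite /padic_ball/= -addrA -opprD.
Qed.

(** Passes between the open balls of the entrywise metric and the closed balls of [padic_ball]:
    every positive radius exceeds some power of [p]. *)
Lemma nbhs_padic_ballP x (A : set V) :
  nbhs x A <-> exists k, padic_ball x (p%:R ^ k) `<=` A.
Proof.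
split => [/nbhs_ballP[e /= e0 xA]|[k kA]].
  have [k ke] := prime_expz_small p_pr e0.
  exists k => y yx; apply: xA; split => // i j.
  rewrite ballEmdist/=; apply: le_lt_trans ke.
  move/vnorm_leP: (padic_ball_sym yx) => /(_ (ltW (prime_expz_gt0 p_pr k)) j).
  by rewrite 2!mxE ord1.
apply/nbhs_ballP; exists (p%:R ^ k); first exact: prime_expz_gt0.
move=> y [_ xy]; apply/kA/padic_ball_sym/vnorm_leP.
  exact/ltW/prime_expz_gt0.
by move=> i; have := xy 0 i; rewrite ballEmdist/= 2!mxE => /ltW.
Qed.

Lemma open_padic_ball x k : open (padic_ball x (p%:R ^ k)).
Proof.
rewrite openE => y yx; apply/nbhs_padic_ballP; exists k => z.
exact: padic_ball_trans.
Qed.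

Lemma open_ball_union c (K : set int) a : open (@ball_union p p_pr d c K a).
Proof. by apply: bigcup_open => ki _; exact: open_padic_ball. Qed.

(** If the balls of radius [p ^ k] around [x] and [y] meet, then [x - y] has norm at most [p ^ k].
    Separation will make compact sets closed. *)
Lemma padic_space_hausdorff : hausdorff_space V.
Proof.
move=> x y xy; apply/rowP => i; apply/eqP; rewrite -subr_eq0; apply/eqP.
apply: padic_norm_eq0; apply/eqP; rewrite eq_le padic_norm_ge0 andbT leNgt.
apply/negP => /(prime_expz_small p_pr)[k]; apply/negP; rewrite -leNgt.
have [z [xz yz]] := xy _ _ ((nbhs_padic_ballP x _).2 (ex_intro _ k (@subset_refl _ _)))
  ((nbhs_padic_ballP y _).2 (ex_intro _ k (@subset_refl _ _))).
have /vnorm_leP := padic_ball_trans yz (padic_ball_sym xz).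
by move=> /(_ (ltW (prime_expz_gt0 p_pr k)) i); rewrite 2!mxE.
Qed.

End Balls.

(** * Compactness of balls *)

Lemma ultra_bigcup_lt (T : Type) (F : set_system T) (B : nat -> set T) N :
  UltraFilter F -> F [set x | exists2 r, (r < N)%N & B r x] ->
  exists r, F (B r).
Proof.
move=> FU; elim: N => [|N IH] FN.
  by have /filter_ex[x []] : F set0 by apply: filterS FN => x [].
have [|FC] := in_ultra_setVsetC (B N) FU; first by exists N.
apply: IH; apply: filterS (filterI FN FC) => x [[r rN Brx] nBNx].
exists r => //; rewrite ltn_neqAle -ltnS rN andbT.
by apply: contra_notN nBNx => /eqP <-.
Qed.

Section Compact.
Variables (p : nat) (p_pr : prime p).
Local Notation Zp := (padic_int p_pr).
Local Notation Qp := (padic p_pr).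

Lemma res_eq0_dvd (a : Zp) n : res a n = 0%N -> exists b, a = p%:R ^+ n * b.
Proof.
elim: n a => [|n IH] a an; first by exists a; rewrite mul1r.
have [b ab] : exists b, a = p%:R * b.
  by apply: zp_div; rewrite -(res_trunc a 1 n) add1n an mod0n.
have [c bc] : exists c, b = p%:R ^+ n * c; last first.
  by exists c; rewrite ab bc exprS mulrA.
apply: IH; rewrite -(res_coherent b) /=; apply/eqP.
have /eqP := an; rewrite ab resM res_nat modnMml -/(dvdn _ _) expnS.
by rewrite dvdn_pmul2l// prime_gt0.
Qed.

Lemma padic_norm_res (a b : Zp) n : res a n = res b n ->
  padic_norm (zp2qp a - zp2qp b) <= p%:R ^ (- n%:Z).
Proof.
move=> ab; have [|c abc] := @res_eq0_dvd (a - b) n.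
  have E : res (a - b + b) n = res b n by rewrite subrK.
  have /eqP : (res (a - b)%R n + res b n = 0 + res b n %[mod p ^ n])%N.
    by rewrite -resD E add0n res_mod.
  by rewrite eqn_modDr res_mod mod0n => /eqP.
rewrite -rmorphB abc rmorphM rmorphXn rmorph_nat padic_normM exprnP.
rewrite padic_norm_expz ler_piMr ?padic_norm_zp ?ltW ?prime_expz_gt0//.
Qed.

Lemma compact_zp : compact [set x : Qp | padic_norm x <= 1].
Proof.
rewrite compact_ultra => F FU FZ.
pose B n r := [set x : Qp | exists2 a : Zp, x = zp2qp a & res a n = r].
have /choice[f fP] n : exists r, F (B n r).
  apply: (@ultra_bigcup_lt _ _ (B n) (p ^ n)); apply: filterS FZ => x /=.
  move=> /padic_norm_le1[a ->]; exists (res a n); last by exists a.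
  by rewrite -res_mod ltn_mod expn_gt0 prime_gt0.
(* Two sets of the ultrafilter meet, and a common point carries both residues [f n.+1] and [f n]. *)
have fc : coherent p f.
  move=> n; have [x [[a xa <-] [b xb <-]]] := filter_ex (filterI (fP n.+1) (fP n)).
  have <- : a = b by apply: zp2qp_inj; rewrite -xa.
  exact: res_coherent.
exists (zp2qp (PadicInt p_pr fc)); split; first exact: padic_norm_zp.
move=> A /nbhs_ballP[e /= e0 eA].
(* The exponent has to be at most 0; if the one found is not negative, [n = 0] will do. *)
have [n ne] : exists n : nat, p%:R ^ (- n%:Z) < e.
  have [[n|n] ke] := prime_expz_small p_pr e0; last by exists n.+1; rewrite -NegzE.
  by exists 0%N; apply: le_lt_trans ke; rewrite ler_prime_expz.
apply: filterS (fP n) => x [a -> an]; apply: eA.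
by rewrite ballEmdist/=; apply: le_lt_trans ne; exact: padic_norm_res.
Qed.

(** The scalar [p ^ (- k)] has norm [p ^ k], so the ball is the image under a continuous affine map
    of the unit ball, which is a finite power of Z_p. *)
Lemma compact_padic_ball d (c : 'rV[Qp]_d) (k : int) :
  compact (padic_ball c (p%:R ^ k)).
Proof.
have p0 := padicp_neq0 p_pr.
pose f (x : 'rV[Qp]_d) := c + p%:R ^ (- k) *: x.
have fB x y l : padic_ball x (p%:R ^ (l - k)) y -> padic_ball (f x) (p%:R ^ l) (f y).
  move=> /vnorm_leP xy; apply/vnorm_leP => [|i]; first exact/ltW/prime_expz_gt0.
  have := xy (ltW (prime_expz_gt0 p_pr _)) i.
  rewrite /f opprD addrACA subrr add0r -scalerBr.
  rewrite [X in _ -> padic_norm X <= _]mxE padic_normM padic_norm_expz opprK.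
  rewrite -ler_pdivlMl ?prime_expz_gt0// invr_expz.
  by rewrite -expfzDr ?pnatr_eq0 -?lt0n ?prime_gt0// [- k + l]addrC.
have -> : padic_ball c (p%:R ^ k) = f @` padic_ball 0 1.
  apply/seteqP; split => [y yc|_ [x x0 <-]]; last first.
    have := @fB 0 x k; rewrite subrr expr0z /f scaler0 addr0; exact.
  exists (p%:R ^ k *: (y - c)).
    apply/vnorm_leP => // i; rewrite subr0 mxE padic_normM padic_norm_expz.
    rewrite -invr_expz ler_pdivrMl ?prime_expz_gt0// mulr1.
    by apply/vnorm_leP: i; rewrite // ltW// prime_expz_gt0.
  rewrite /f scalerA -expfzDr// addNr expr0z scale1r addrC subrK//.
apply: continuous_compact.
  apply: continuous_subspaceT => x A /nbhs_padic_ballP[l lA].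
  by apply/nbhs_padic_ballP; exists (l - k) => y /fB; exact: lA.
have -> : padic_ball (0 : 'rV[Qp]_d) 1 =
    [set v | forall i, [set x : Qp | padic_norm x <= 1] (v ord0 i)].
  apply/seteqP; split=> v; rewrite /padic_ball/= subr0.
    by move=> /vnorm_leP; exact.
  by move=> h; exact/vnorm_leP.
by apply: (@rV_compact _ _ (fun=> _)) => _; exact: compact_zp.
Qed.

End Compact.

(** * Base-[p] digits, disjointness of the balls, and their volume *)

Lemma digits_inj p d i j : (0 < p)%N -> (i < p ^ d)%N -> (j < p ^ d)%N ->
  (forall n, (n < d)%N -> ((i %/ p ^ n) %% p = (j %/ p ^ n) %% p)%N) -> i = j.
Proof.
move=> p0; elim: d i j => [|d IH] i j.
  by rewrite expn0 !ltnS !leqn0 => /eqP -> /eqP ->.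
rewrite expnSr => id jd ij; rewrite (divn_eq i p) (divn_eq j p).
have /= := ij 0%N isT; rewrite expn0 !divn1 => ->; congr (_ * _ + _)%N.
apply: IH; rewrite ?ltn_divLR// => n nd.
by rewrite -!divnMA -expnS ij.
Qed.

(** Horner's scheme: [g 0] is the lowest digit, and the shifted sequence gives the quotient by
    [p]. *)
Lemma digits_onto p d (g : nat -> nat) : (forall n, g n < p)%N ->
  exists2 i, (i < p ^ d)%N & forall n, (n < d)%N -> ((i %/ p ^ n) %% p = g n)%N.
Proof.
elim: d g => [|d IH] g gp; first by exists 0%N; rewrite ?expn0.
have p0 : (0 < p)%N by apply: leq_ltn_trans (gp 0%N).
have [i id ig] := IH (fun n => g n.+1) (fun n => gp n.+1).
exists (i * p + g 0)%N.
  by rewrite expnSr -ltn_divLR// divnMDl// divn_small ?addn0.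
case=> [|n] nd; first by rewrite expn0 divn1 modnMDl modn_small.
by rewrite expnS divnMA divnMDl// (divn_small (gp 0%N)) addn0 ig.
Qed.

Section Volume.
Variables (p : nat) (p_pr : prime p) (d : nat).
Local Notation V := 'rV[padic p_pr]_d.
Local Notation B := (balls_of (padic_center p_pr d)).
Implicit Types (k : int) (i j : nat).

Let p0 : p%:R != 0 :> rat. Proof. by rewrite pnatr_eq0 -lt0n prime_gt0. Qed.

Lemma padic_center0 k : padic_center p_pr d (k, 0%N) = 0.
Proof. by apply/rowP => j; rewrite !mxE /= div0n mod0n mul0r. Qed.

(** Where two digits differ, the centers are at distance [p ^ (k + 1)], more than the radius. The
    index 0 is allowed: its ball is centered at the origin, and the other balls are compared with it
    below. *)
Lemma center_ball_disjoint k i j : (i < p ^ d)%N -> (j < p ^ d)%N ->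
  B (k, i) `&` B (k, j) !=set0 -> i = j.
Proof.
move=> id jd [y [yi yj]]; apply: (digits_inj (prime_gt0 p_pr) id jd) => n nd.
have pk := ltW (prime_expz_gt0 p_pr k).
have /vnorm_leP/(_ (Ordinal nd)) := padic_ball_trans yj (padic_ball_sym yi).
move=> /(_ pk); rewrite !mxE /= -mulrBl padic_normM padic_norm_expz.
set a := (_ %% _)%N; set b := (_ %% _)%N => ab; apply/eqP; apply: contraTT ab => ab.
rewrite padic_norm_digits ?ltn_mod ?prime_gt0// mul1r -ltNge.
by rewrite ltr_eXz2l ?ltr1n ?prime_gt1// opprD !opprK ltrDl.
Qed.

Lemma sub_center_ball k i : B (k, i) `<=` padic_ball 0 (p%:R ^ (k + 1)).
Proof.
move=> y yi; apply: (@padic_ball_trans _ _ _ _ (padic_center p_pr d (k, i))).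
  apply/vnorm_leP => [|j]; first exact/ltW/prime_expz_gt0.
  rewrite subr0 mxE /= padic_normM padic_norm_expz opprD !opprK ler_piMl//.
    exact/ltW/prime_expz_gt0.
  by rewrite -(rmorph_nat (@zp2qp _ p_pr)) padic_norm_zp.
apply: sub_padic_ball yi; rewrite (ler_prime_expz p_pr) /=; lia.
Qed.

(** For [k < k'], the ball [B (k, i)] lies in the ball of radius [p ^ k'] around the origin, which
    is [B (k', 0)] and thus disjoint from [B (k', i')]. *)
Lemma center_ball_level k i k' i' : (0 < i < p ^ d)%N -> (0 < i' < p ^ d)%N ->
  B (k, i) `&` B (k', i') !=set0 -> k = k'.
Proof.
wlog kk' : k i k' i' / k < k' =>
    [h i0 i'0 [y [yi yi']]|/andP[i0 id] /andP[i'0 i'd] [y [yi yi']]].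
  have [kk'|k'k|//] := ltgtP k k'; first by apply: (h k i k' i'); rewrite //; exists y.
  by apply/esym; apply: (h k' i' k i); rewrite //; exists y.
suff : i' = 0%N by move=> i'E; rewrite i'E in i'0.
apply: (@center_ball_disjoint k'); rewrite ?expn_gt0 ?prime_gt0//.
exists y; split => //; rewrite /balls_of padic_center0 /=.
apply: sub_padic_ball (sub_center_ball yi).
by rewrite (ler_prime_expz p_pr) /=; lia.
Qed.

(* The points of [B (k, i)], [i != 0], have norm exactly [p ^ (k + 1)], which
   separates the levels; within a level the balls differ in a digit of the
   center. *)
Lemma trivIset_center_balls :
  trivIset [set ki : int * nat | (1 <= ki.2 <= (p ^ d).-1)%N] B.
Proof.
have E i : (1 <= i <= (p ^ d).-1)%N = (0 < i < p ^ d)%N.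
  by have : (0 < p ^ d)%N; [rewrite expn_gt0 prime_gt0 | lia].
move=> [k i] [k' i']; rewrite /= !E => iP i'P ii'.
have kk' := center_ball_level iP i'P ii'; rewrite -{}kk' in ii' *.
congr pair; case/andP: iP => _ id; case/andP: i'P => _ i'd.
exact: center_ball_disjoint ii'.
Qed.

(** Multiplied by [p ^ (k + 1)], the coordinates of a point of the large ball become p-adic
    integers; their residues modulo [p] are the digits of the index. *)
Lemma padic_ball_partition k :
  padic_ball 0 (p%:R ^ (k + 1)) = \big[setU/set0]_(i < p ^ d) B (k, nat_of_ord i).
Proof.
rewrite -(bigcup_mkord _ (fun i => B (k, i))); apply/seteqP; split => [y y0|y [i _]]; last first.
  exact: sub_center_ball.
have pk := prime_expz_gt0 p_pr.
have /choice[z zP] (j : 'I_d) : exists z, y 0 j * p%:R ^ (k + 1) = zp2qp z.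
  apply: padic_norm_le1; rewrite padic_normM padic_norm_expz -invr_expz.
  rewrite ler_pdivrMr// mul1r.
  by have /vnorm_leP := y0; rewrite subr0; apply; exact: ltW.
(* [digits_onto] takes a digit at every position; those from [d] on are never read. *)
pose g n := if insub n is Some j then res (z j) 1 else 0%N.
have [|i id ig] := @digits_onto p d g.
  move=> n; rewrite /g; case: insubP => [j _ _|_]; last exact: prime_gt0.
  by rewrite -res_mod expn1 ltn_mod prime_gt0.
exists i => //; apply/vnorm_leP => [|j]; first exact: ltW.
rewrite !mxE /= ig// /g valK.
have /eqP -> : y 0 j == zp2qp (z j) * p%:R ^ (- k - 1).
  by rewrite -zP -mulrA -expfzDr ?padicp_neq0// -opprD subrr expr0z mulr1.
rewrite -mulrBl padic_normM padic_norm_expz.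
(* A p-adic integer is within [p ^ (- 1)] of its residue modulo [p]; scaling back multiplies
   distances by [p ^ (k + 1)]. *)
have -> : p%:R ^ k = p%:R ^ (- 1%:Z) * p%:R ^ (- (- k - 1)) :> rat.
  by rewrite -expfzDr//; congr (_ ^ _); lia.
rewrite ler_pM2r// -(rmorph_nat (@zp2qp _ p_pr)); apply: padic_norm_res.
by rewrite res_nat res_mod.
Qed.

Variable R : realType.
Local Notation b := ((p ^ d)%:R : R).

Lemma measurable_padic_ball (x : V) k :
  measurable (padic_ball x (p%:R ^ k) : set (padic_borel p_pr d)).
Proof. by apply: sub_sigma_algebra; exact: open_padic_ball. Qed.

Section Haar.
Variable mu : {measure set (padic_borel p_pr d) -> \bar R}.
Hypothesis haar_mu : normalized_haar mu.

Lemma haar_ball_shift (x : V) k :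
  mu (padic_ball x (p%:R ^ k)) = mu (padic_ball 0 (p%:R ^ k)).
Proof.
have [muD _] := haar_mu; rewrite -(muD x (padic_ball 0 (p%:R ^ k))).
  by rewrite padic_ball_shift addr0.
exact: measurable_padic_ball.
Qed.

(** The [p ^ d] pieces of the partition are translates of one ball. *)
Lemma haar_ballS k (v : R) : mu (padic_ball 0 (p%:R ^ k)) = v%:E ->
  mu (padic_ball 0 (p%:R ^ (k + 1))) = (b * v)%:E.
Proof.
move=> kv; rewrite padic_ball_partition.
rewrite (@measure_bigsetU_ord _ _ _ mu _ predT
  (fun i : 'I_(p ^ d) => B (k, nat_of_ord i))).
- rewrite (eq_bigr (fun=> v%:E)) => [|i _].
    by rewrite sumEFin sumr_const card_ord mulr_natl.
  exact: etrans (haar_ball_shift _ _) kv.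
- by move=> i; exact: measurable_padic_ball.
- move=> i j _ _ ij; apply: val_inj.
  exact: (center_ball_disjoint (ltn_ord i) (ltn_ord j) ij).
Qed.

(* Going down from a ball to the next smaller one, monotonicity of [mu] is needed
   to exclude that the smaller ball has infinite measure. *)
Lemma haar_ball (x : V) k : mu (padic_ball x (p%:R ^ k)) = (b ^ k)%:E.
Proof.
rewrite haar_ball_shift.
have b0 : b != 0 by rewrite pnatr_eq0 -lt0n expn_gt0 prime_gt0.
elim/int_rec: k => [|n IH|n IH]; first by rewrite !expr0z; case: haar_mu.
  by rewrite intS addrC (haar_ballS IH) [_ + 1]addrC expfzDr.
set k : int := - n.+1%:Z in IH *.
have kn : k + 1 = - n%:Z by rewrite /k; lia.
have fin : mu (padic_ball 0 (p%:R ^ k)) \is a fin_num.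
  rewrite ge0_fin_numE// (@le_lt_trans _ _ (mu (padic_ball 0 (p%:R ^ (- n%:Z)))))//.
    apply: le_measure; rewrite ?inE; [exact: measurable_padic_ball..|].
    by apply: sub_padic_ball; rewrite (ler_prime_expz p_pr) -kn /=; lia.
  by rewrite IH ltry.
have := haar_ballS (esym (fineK fin)); rewrite kn IH => -[kE].
rewrite -(fineK fin); congr EFin; apply: (mulfI b0); rewrite -kE -kn.
by rewrite [_ + 1]addrC expfzDr.
Qed.

End Haar.
End Volume.

(** * Volume and compactness of the unions of balls *)

Section Manifold.
Variables (p : nat) (p_pr : prime p) (d : nat).
Local Notation V := 'rV[padic p_pr]_d.
Local Notation B := (balls_of (padic_center p_pr d)).
Implicit Types (k l m : int) (a : int -> nat).

(** Grouping the balls by radius leaves a union over one integer, in which each level accounts for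
    one digit. *)
Lemma ball_union_levels (c : int * nat -> V) (K : set int) a :
  ball_union c K a =
  \bigcup_(k in K) \bigcup_(i in [set i | (1 <= i <= a k)%N]) balls_of c (k, i).
Proof.
apply/seteqP; split => [x [[k i] [Kk ia] xki]|x [k Kk [i ia xki]]].
  by exists k => //; exists i.
by exists (k, i).
Qed.

Lemma digit_lt (i n : nat) :
  (n <= (p ^ d).-1)%N -> (1 <= i <= n)%N -> (0 < i < p ^ d)%N.
Proof. by have : (0 < p ^ d)%N; [rewrite expn_gt0 prime_gt0 | lia]. Qed.

Lemma level_disjoint k k' (n n' : nat) :
  (n <= (p ^ d).-1)%N -> (n' <= (p ^ d).-1)%N ->
  (\bigcup_(i in [set i | (1 <= i <= n)%N]) B (k, i)) `&`
  (\bigcup_(i in [set i | (1 <= i <= n')%N]) B (k', i)) !=set0 -> k = k'.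
Proof.
move=> nb nb' [x [[i iP xi] [j jP xj]]].
by apply: (center_ball_level (digit_lt nb iP) (digit_lt nb' jP)); exists x.
Qed.

Section Haar.
Variable R : realType.
Local Notation b := ((p ^ d)%:R : R).
Variable mu : {measure set (padic_borel p_pr d) -> \bar R}.
Hypothesis haar_mu : normalized_haar mu.

Lemma measurable_level k (n : nat) : measurable
  (\bigcup_(i in [set i | (1 <= i <= n)%N]) B (k, i) : set (padic_borel p_pr d)).
Proof.
apply: sub_sigma_algebra; apply: bigcup_open => i _; exact: open_padic_ball.
Qed.

Lemma haar_level k (n : nat) : (n <= (p ^ d).-1)%N ->
  mu (\bigcup_(i in [set i | (1 <= i <= n)%N]) B (k, i)) = (n%:R * b ^ k)%:E.
Proof.
move=> nb; have -> : \bigcup_(i in [set i | (1 <= i <= n)%N]) B (k, i) =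
    \big[setU/set0]_(i < n) B (k, i.+1).
  rewrite -(bigcup_mkord _ (fun i => B (k, i.+1))).
  apply/seteqP; split=> x [i /= iP xi]; last by exists i.+1.
  by case: i iP xi => // i iP xi; exists i.
rewrite (@measure_bigsetU_ord _ _ _ mu _ predT (fun i : 'I_n => B (k, i.+1))).
- rewrite (eq_bigr (fun=> (b ^ k)%:E)) => [|i _].
    by rewrite sumEFin sumr_const card_ord mulr_natl.
  exact: haar_ball.
- by move=> i; exact: measurable_padic_ball.
- move=> i j _ _ ij; apply: val_inj; apply: succn_inj.
  by apply: (center_ball_disjoint _ _ ij); have := ltn_ord i; have := ltn_ord j; lia.
Qed.

Lemma haar_finite_manifold l m a :
  l <= m -> (forall k, l <= k <= m -> (a k <= (p ^ d).-1)%N) ->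
  mu (padic_manifold p_pr d [set k | l <= k <= m] a) =
  (\sum_(n < `|m - l|.+1) (a (l + n%:Z))%:R * b ^ (l + n%:Z))%:E.
Proof.
move=> lm ab; rewrite /padic_manifold ball_union_levels.
pose U k := \bigcup_(i in [set i | (1 <= i <= a k)%N]) B (k, i).
have inK (n : 'I_(`|m - l|.+1)) : l <= l + n%:Z <= m by have := ltn_ord n; lia.
have -> : \bigcup_(k in [set k | l <= k <= m]) U k =
    \big[setU/set0]_(n < `|m - l|.+1) U (l + n%:Z).
  rewrite -(bigcup_mkord _ (fun n => U (l + n%:Z))).
  apply/seteqP; split=> x [k /= kP xk]; last first.
    by exists (l + k%:Z) => //; exact: (inK (Ordinal kP)).
  exists (`|k - l|%N); rewrite /=; first lia.
  by have -> : l + `|k - l|%N%:Z = k by lia.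
rewrite (@measure_bigsetU_ord _ _ _ mu _ predT
  (fun n : 'I_(`|m - l|.+1) => U (l + n%:Z))).
- by rewrite -sumEFin; apply: eq_bigr => n _; apply: haar_level; exact/ab/inK.
- by move=> n; exact: measurable_level.
- move=> i j _ _ ij; apply: val_inj => /=.
  by have := level_disjoint (ab _ (inK i)) (ab _ (inK j)) ij; lia.
Qed.

(** Levels are enumerated downwards from [m], so that the partial sums in countable additivity are
    those of the expansion. *)
Lemma haar_infinite_manifold m a (v : R) :
  (forall k, k <= m -> (a k <= (p ^ d).-1)%N) ->
  series (fun n => (a (m - n%:Z))%:R * b ^ (m - n%:Z)) @ \oo --> v ->
  mu (padic_manifold p_pr d [set k | k <= m] a) = v%:E.
Proof.
move=> ab av; rewrite /padic_manifold ball_union_levels.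
pose U k := \bigcup_(i in [set i | (1 <= i <= a k)%N]) B (k, i).
have inK (n : nat) : m - n%:Z <= m by lia.
have -> : \bigcup_(k in [set k | k <= m]) U k = \bigcup_n U (m - n%:Z).
  apply/seteqP; split=> x [k /= kP xk]; last by exists (m - k%:Z) => //; exact: inK.
  by exists (`|m - k|%N) => //; have -> : m - `|m - k|%N%:Z = k by lia.
have Um n : measurable (U (m - n%:Z) : set (padic_borel p_pr d)).
  exact: measurable_level.
rewrite (@measure_semi_bigcup _ _ _ mu (fun n => U (m - n%:Z))) //.
- apply/cvg_lim => //; apply: (@cvg_trans _ (EFin \o
      series (fun n => (a (m - n%:Z))%:R * b ^ (m - n%:Z)) @ \oo)).
    apply: near_eq_cvg; apply: nearW => n /=; rewrite /series/= -sumEFin.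
    apply: eq_bigr => i _; exact/esym/haar_level/ab/inK.
  apply: cvg_EFin; [exact: nearW | exact: av].
- move=> i j _ _ ij.
  by have := level_disjoint (ab _ (inK i)) (ab _ (inK j)) ij; lia.
- exact: bigcupT_measurable.
Qed.

End Haar.

Lemma finite_int_segment l m : finite_set [set k : int | l <= k <= m].
Proof.
apply: (@sub_finite_set _ _ ((fun n : nat => l + n%:Z) @` `I_(`|m - l|.+1))).
  by move=> k /= kP; exists (`|k - l|%N) => /=; lia.
exact/finite_image/finite_II.
Qed.

Lemma compact_finite_manifold l m a :
  compact (padic_manifold p_pr d [set k | l <= k <= m] a).
Proof.
rewrite /padic_manifold ball_union_levels.
rewrite -bigsetU_fset_set; last exact: finite_int_segment.
apply: bigsetU_compact => k _; rewrite -bigsetU_fset_set.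
  by apply: bigsetU_compact => i _; exact: compact_padic_ball.
apply: (@sub_finite_set _ _ `I_(a k).+1); last exact: finite_II.
by move=> i /= /andP[_]; rewrite ltnS.
Qed.

(* The balls accumulate at the origin, which belongs to none of them. *)
Lemma not_compact_infinite_manifold m a :
  (forall k, k <= m -> (a k <= (p ^ d).-1)%N) ->
  infinite_set [set k : int | k <= m /\ a k != 0%N] ->
  ~ compact (padic_manifold p_pr d [set k | k <= m] a).
Proof.
move=> ab ainf /(compact_closed (@padic_space_hausdorff _ p_pr d)) Mcl.
have [[k i] [/= km ia]] : padic_manifold p_pr d [set k | k <= m] a 0.
  apply: Mcl => A /nbhs_padic_ballP[l lA].
  have [k [km [ak kl]]] : exists k, k <= m /\ a k != 0%N /\ k < l.
    apply: contrapT => nk; apply: ainf.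
    apply: (sub_finite_set _ (finite_int_segment l m)) => k [km ak] /=.
    by rewrite km andbT leNgt; apply/negP => kl; apply: nk; exists k.
  have Bk : B (k, 1%N) (padic_center p_pr d (k, 1%N)).
    by apply: padic_ball_center; exact/ltW/prime_expz_gt0.
  exists (padic_center p_pr d (k, 1%N)); split.
    by exists (k, 1%N) => //; split=> //=; lia.
  apply: lA; apply: sub_padic_ball (sub_center_ball Bk).
  by rewrite (ler_prime_expz p_pr) /=; lia.
have [i0 id] := andP (digit_lt (ab _ km) ia); move=> Bi.
(* The origin also lies in the ball of index 0 of the same level. *)
suff iE : i = 0%N by rewrite iE in i0.
apply: (@center_ball_disjoint p p_pr d k) => //; first by rewrite expn_gt0 prime_gt0.
exists 0; split => //; rewrite /balls_of padic_center0.
by apply: padic_ball_center; exact/ltW/prime_expz_gt0.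
Qed.

End Manifold.

(** * Piecewise translations between families of balls *)

Section Symplectic.
Variables (p : nat) (p_pr : prime p) (d : nat).
Local Notation V := 'rV[padic p_pr]_d.
Implicit Types (x y z t : V).

Let mul0 : {ffun 'I_d -> nat} := [ffun=> 0%N].
Let mul1 (j : 'I_d) : {ffun 'I_d -> nat} := [ffun i => (i == j) : nat].

Lemma monomial0 x : padic_monomial x mul0 = 1.
Proof. by apply: big1 => i _; rewrite ffunE. Qed.

Lemma monomial1 x j : padic_monomial x (mul1 j) = x 0 j.
Proof.
rewrite /padic_monomial (bigD1 j)//= ffunE eqxx expr1 big1 ?mulr1// => i ij.
by rewrite ffunE (negPf ij).
Qed.

Lemma partial_sum_single (I : choiceType) (U : zmodType) (F : I -> U) (z : I)
    (A : {fset I}) : z \in A ->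
  summability.partial_sum (fun i => if i == z then F i else 0) A = F z.
Proof.
move=> zA; rewrite /summability.partial_sum (bigD1 [` zA]%fset)//= eqxx.
by rewrite big1 ?addr0// => i /negPf; rewrite -val_eqE /= => ->.
Qed.

(** A translation is a polynomial of degree 1: constant term [t], and the standard basis vectors as
    linear coefficients. *)
Lemma translation_power_series (B : set V) (c t : V) (f : V -> V) :
  (forall y, B y -> f y = y - c + t) ->
  power_series_on B c (fun I => (if I == mul0 then t else 0)
    + \sum_j (if I == mul1 j then delta_mx 0 j else 0)) f.
Proof.
move=> fB y By A /nbhs_singleton Afy.
(* Over any finite set containing these multi-indices, the partial sum equals [f y], so convergence
   needs no estimate. *)
exists [fset I in mul0 :: [seq mul1 j | j <- enum 'I_d]]%fset => //= S /fsubsetP sS.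
apply: (@eq_ind_r _ (f y) A Afy).
rewrite fB// (addrC _ t).
transitivity (summability.partial_sum (fun I =>
    (if I == mul0 then padic_monomial (y - c) I *: t else 0)
    + \sum_j (if I == mul1 j then padic_monomial (y - c) I *: delta_mx 0 j else 0)) S).
  apply: eq_bigr => I _; rewrite scalerDr scaler_sumr; congr (_ + _).
    by case: ifP => // _; rewrite scaler0.
  by apply: eq_bigr => j _; case: ifP => // _; rewrite scaler0.
rewrite /summability.partial_sum big_split/=; congr (_ + _).
  rewrite -[LHS]/(summability.partial_sum (fun I => if I == mul0 then
    padic_monomial (y - c) I *: t else 0) S) partial_sum_single.
    by rewrite monomial0 scale1r.
  by apply: sS; rewrite !inE eqxx.
rewrite exchange_big/= [RHS]row_sum_delta; apply: eq_bigr => j _.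
rewrite -[LHS]/(summability.partial_sum (fun I => if I == mul1 j then
  padic_monomial (y - c) I *: delta_mx 0 j else 0) S) partial_sum_single.
  by rewrite monomial1.
by apply: sS; rewrite !inE map_f ?mem_enum ?orbT.
Qed.

Section Rearrange.
Variables (I : set (int * nat)) (c c' : int * nat -> V).
Hypotheses (tc : trivIset I (balls_of c)) (tc' : trivIset I (balls_of c')).

(** Disjointness makes the index unique on the union; the default [(0, 0)] is taken only outside
    it. *)
Definition ball_index (b : int * nat -> V) (x : V) : int * nat :=
  xget (0, 0%N) [set ki | I ki /\ balls_of b ki x].

Definition ball_shift (b b' : int * nat -> V) (x : V) : V :=
  x - b (ball_index b x) + b' (ball_index b x).

Lemma ball_indexE b ki x : trivIset I (balls_of b) -> I ki -> balls_of b ki x ->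
  ball_index b x = ki.
Proof.
move=> tb Iki xki; rewrite /ball_index; case: xgetP => [kj _ [Ikj xkj]|/(_ ki)].
  by apply: tb => //; exists x.
by case.
Qed.

Lemma ball_shiftE b b' ki x : trivIset I (balls_of b) -> I ki ->
  balls_of b ki x -> ball_shift b b' x = x - b ki + b' ki.
Proof. by move=> tb Iki xki; rewrite /ball_shift (ball_indexE tb Iki xki). Qed.

Lemma ball_shift_in b b' ki x : trivIset I (balls_of b) -> I ki ->
  balls_of b ki x -> balls_of b' ki (ball_shift b b' x).
Proof.
move=> tb Iki xki; rewrite (ball_shiftE b' tb Iki xki).
by rewrite /balls_of /padic_ball/= addrK.
Qed.

Lemma ball_shiftK b b' x :
  trivIset I (balls_of b) -> trivIset I (balls_of b') ->
  (\bigcup_(ki in I) balls_of b ki) x -> ball_shift b' b (ball_shift b b' x) = x.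
Proof.
move=> tb tb' [ki Iki xki].
rewrite (ball_shiftE b tb' Iki (ball_shift_in b' tb Iki xki)).
by rewrite (ball_shiftE b' tb Iki xki) addrK subrK.
Qed.

Lemma ball_shift_analytic b b' : trivIset I (balls_of b) ->
  padic_analytic (\bigcup_(ki in I) balls_of b ki) (ball_shift b b').
Proof.
move=> tb x [ki Iki xki]; exists (b ki), ki.1; split => //.
  by move=> y yki; exists ki.
eexists; apply: (@translation_power_series _ _ (b' ki)) => y.
exact: ball_shiftE.
Qed.

(** Inside the ball of [x] the map is a single translation, so the remainder is exactly zero. *)
Lemma ball_shift_diff b b' ki x : trivIset I (balls_of b) -> I ki ->
  balls_of b ki x -> is_padic_diff (ball_shift b b') x 1%:M.
Proof.
move=> tb Iki xki e e0; apply/nbhs_padic_ballP; exists ki.1 => h.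
rewrite /padic_ball/= subr0 => hk.
have xhki : balls_of b ki (x + h).
  by apply: (padic_ball_trans xki); rewrite /padic_ball/= addrAC subrr add0r.
rewrite (ball_shiftE b' tb Iki xki) (ball_shiftE b' tb Iki xhki) mulmx1.
have -> : x + h - b ki + b' ki = h + (x - b ki + b' ki).
  by rewrite [x + h]addrC -!addrA.
by rewrite addrK subrr vnorm0 mulr_ge0 ?vnorm_ge0// ltW.
Qed.

Lemma rearrange_symplectomorphic :
  symplectomorphic (\bigcup_(ki in I) balls_of c ki) standard_symplectic
    (\bigcup_(ki in I) balls_of c' ki) standard_symplectic.
Proof.
have im b b' : trivIset I (balls_of b) -> set_fun (\bigcup_(ki in I) balls_of b ki)
    (\bigcup_(ki in I) balls_of b' ki) (ball_shift b b').
  by move=> tb x [ki Iki xki]; exists ki => //; exact: ball_shift_in.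
exists (ball_shift c c'), (ball_shift c' c); split.
- by split; [exact: im|exact: im|move=> x; exact: ball_shiftK..].
- exact: ball_shift_analytic.
- exact: ball_shift_analytic.
(* With the identity as Jacobian, the pullback has the same constant Gram matrix. *)
- move=> x [ki Iki xki]; exists 1%:M; split; first exact: ball_shift_diff xki.
  by rewrite trmx1 mulmx1 mul1mx.
Qed.

End Rearrange.
End Symplectic.

(** * Existence of the expansions *)

Lemma sum_digits b N M : (1 < b)%N -> (M < b ^ N)%N ->
  (\sum_(n < N) ((M %/ b ^ n) %% b) * b ^ n = M)%N.
Proof.
move=> b1; elim: N M => [|N IH] M; first by rewrite expn0 big_ord0 ltnS leqn0 => /eqP.
rewrite expnSr -ltn_divLR ?(ltn_trans _ b1)// => /IH MN.
rewrite big_ord_recl /= expn0 divn1 muln1 [RHS](divn_eq M b) addnC; congr (_ + _)%N.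
rewrite -[in RHS]MN big_distrl /=; apply: eq_bigr => n _.
by rewrite /bump /= add1n expnS divnMA -mulnA [(b * _)%N]mulnC.
Qed.

Lemma infinite_unbounded_below (A : set int) :
  (forall l, exists2 k, k < l & A k) -> infinite_set A.
Proof.
move=> Al /finite_seqP[s As].
have [k kl] := Al (\big[Num.min/0]_(i <- s) i).
rewrite As /= => ks; move: kl; apply/negP; rewrite -leNgt.
elim: s {As} ks => //= i s IH; rewrite inE big_cons ge_min.
by move=> /orP[/eqP ->|/IH ->]; rewrite ?lexx ?orbT.
Qed.

Section Expansion.
Variable R : realType.
Implicit Types (b : nat) (v : R).

(** An integer [v] is rounded to [v - 1]; this strictness selects the expansion with infinitely many
    nonzero digits. *)
Lemma pred_ceil v : 0 < v -> exists n : nat, n%:R < v <= n.+1%:R.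
Proof.
move=> v0; have vN : exists n : nat, v <= n%:R.
  by exists (Num.truncn v).+1; rewrite ltW// truncnS_gt.
case: (ex_minnP vN) => -[|n] vn minn; first by rewrite leNgt v0 in vn.
exists n; rewrite vn andbT ltNge; apply/negP => /minn.
by rewrite ltnn.
Qed.

(* The partial sums are the largest multiples of the powers of [b] that are
   strictly below [v], so that no partial sum reaches [v]. *)
Lemma ex_infinite_expansion b v : (1 < b)%N -> 0 < v ->
  exists m a, infinite_expansion b v m a.
Proof.
move=> b1 v0; have b0 : 0 < b%:R :> R by rewrite ltr0n ltnW.
have bneq0 : b%:R != 0 :> R by rewrite gt_eqF.
have bk k : 0 < b%:R ^ k :> R by rewrite exprz_gt0.
have bS (k : int) : b%:R ^ (k + 1) = b%:R * b%:R ^ k :> R by rewrite [k + 1]addrC expfzDr.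
have /choice[C CP] k : exists n : nat, n%:R * b%:R ^ k < v <= n.+1%:R * b%:R ^ k.
  have [|n nv] := @pred_ceil (v / b%:R ^ k); first exact: divr_gt0.
  by exists n; rewrite -ltr_pdivlMr// -ler_pdivrMr.
have Clt k : (C k)%:R * b%:R ^ k < v by case/andP: (CP k).
have Cge k : v <= (C k).+1%:R * b%:R ^ k by case/andP: (CP k).
(* Comparing the bounds at [k] and [k + 1] in units of [b ^ k]: [Cle] makes the truncated
   subtraction defining [a] exact, and [CgeS] keeps its result below [b]. *)
have Cle (k : int) : (b * C (k + 1)%R <= C k)%N.
  rewrite -ltnS -(ltr_nat R) -(ltr_pM2r (bk k)) natrM [b%:R * _]mulrC -mulrA -bS.
  exact: lt_le_trans (Clt _) (Cge _).
have CgeS (k : int) : (C k < b * (C (k + 1)%R).+1)%N.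
  rewrite -(ltr_nat R) -(ltr_pM2r (bk k)) natrM [b%:R * _]mulrC -mulrA -bS.
  exact: lt_le_trans (Clt _) (Cge _).
pose a (k : int) := (C k - b * C (k + 1)%R)%N.
(* Some [n] satisfies [v < n <= b ^ (n + 1)], so there is nothing to record above position [n]. *)
have [m Cm] : exists m, C (m + 1) = 0%N.
  pose n := (Num.truncn v).+1; exists n%:Z; apply/eqP; rewrite -leqn0 -ltnS.
  rewrite -(ltr_nat R) -(ltr_pM2r (bk (n%:Z + 1))) mul1r (lt_trans (Clt _))//.
  rewrite (lt_le_trans (truncnS_gt v))// -/n bS -exprnP -natrX -natrM.
  by rewrite ler_nat -expnS (leq_trans (ltnW (ltn_expl n b1)))// leq_pexp2l// ltnW.
exists m, a; rewrite /infinite_expansion; set u := series _.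
(* The sum telescopes, starting from [C (m + 1) = 0]. *)
have uE n : u n = (C (m + 1 - n%:Z))%:R * b%:R ^ (m + 1 - n%:Z).
  rewrite /u; elim: n => [|n IH]; first by rewrite /series/= big_geq// subr0 Cm mul0r.
  rewrite seriesSr IH; have -> : m + 1 - n%:Z = m - n%:Z + 1 by lia.
  have -> : m + 1 - n.+1%:Z = m - n%:Z by lia.
  rewrite /a natrB// bS mulrBl natrM -!mulrA; ring.
have ucvg : u @ \oo --> v.
  (* By [Cge], the error after [n] terms is at most [b ^ (m + 1 - n)]. *)
  apply: (@squeeze_cvgr _ _ _ _ (fun n => v - b%:R ^ (m + 1) * b%:R^-1 ^+ n) (cst v)).
  - apply: nearW => n; rewrite uE (ltW (Clt _)) andbT lerBlDr.
    rewrite (le_trans (Cge (m + 1 - n%:Z)))// -natr1 mulrDl mul1r lerD2l.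
    by rewrite expfzDr// -exprnN exprVn.
  - rewrite -[X in _ --> X]subr0; apply: cvgB; first exact: cvg_cst.
    rewrite -[X in _ --> X](mulr0 (b%:R ^ (m + 1))); apply: cvgMr.
    by apply: cvg_expr; rewrite ger0_norm ?invr_ge0 ?ler0n// invf_lt1 ?ltr1n.
  - exact: cvg_cst.
split => //.
  by move=> k _; have := CgeS k; rewrite /a mulnS; have := Cle k; lia.
(* Were all digits below [l] zero, the partial sums would be constant from [n0] on, and their limit
   [v] would be one of them; but all are strictly below [v]. *)
apply: infinite_unbounded_below => l; apply: contrapT => nl.
pose n0 := `|m - l|.+1%N.
have ucst n : u (n0 + n)%N = u n0.
  elim: n => [|n IH]; first by rewrite addn0.
  rewrite addnS /u seriesSr -/u IH.
  have -> : a (m - (n0 + n)%N%:Z) = 0%N; last by rewrite mul0r addr0.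
  apply/eqP; apply: contrapT => /negP ak; apply: nl.
  by exists (m - (n0 + n)%N%:Z); [rewrite /n0; lia|split; [lia|]].
have : u @ \oo --> u n0.
  apply: cvg_near_cst; exists n0 => // n /= n0n.
  by rewrite -(subnKC n0n) ucst.
move=> /(cvg_unique (@Rhausdorff R) ucvg) vE.
by have := Clt (m + 1 - n0%:Z); rewrite -uE -vE ltxx.
Qed.

Lemma ex_finite_expansion (p d : nat) v : prime p -> (0 < d)%N -> 0 < v ->
  (exists q : rat, v = ratr q /\ exists e : nat, denq q = (p ^ e)%N%:Z) ->
  exists l m a, finite_expansion (p ^ d)%N v l m a.
Proof.
move=> p_pr d0 v0 [q [vq [e qe]]].
have p0 := prime_gt0 p_pr.
have b1 : (1 < p ^ d)%N by rewrite -(expn0 p) ltn_exp2l// prime_gt1.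
have b0 : (p ^ d)%:R != 0 :> R by rewrite pnatr_eq0 -lt0n expn_gt0 p0.
(* Multiplying numerator and denominator by [p ^ ((d - 1) * e)] turns the denominator [p ^ e] into
   [(p ^ d) ^ e]; the digits of [v] are then those of [M], shifted by [e]. *)
pose M := (`|numq q| * p ^ (d.-1 * e))%N.
have vM : v = M%:R * (p ^ d)%:R ^ (- e%:Z).
  have q0 : 0 < numq q by rewrite numq_gt0 -(ltr0q R) -vq.
  rewrite vq /ratr qe -exprnN /M -natrX -expnM.
  have -> : (d * e = d.-1 * e + e)%N by rewrite -{1}(prednK d0) mulSn addnC.
  rewrite expnD.
  have -> : (numq q)%:~R = `|numq q|%:R :> R by rewrite -[in LHS](gtz0_abs q0).
  rewrite !natrM invfM mulrA mulfK//.
  by rewrite pnatr_eq0 -lt0n expn_gt0 p0.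
(* Since [M < (p ^ d) ^ M], the [M + 1] lowest digits suffice; leading zeros are allowed. *)
exists (- e%:Z), (- e%:Z + M%:Z), (fun k : int => (M %/ (p ^ d) ^ `|(k + e%:Z)%R|) %% p ^ d)%N.
split; first lia.
  by move=> k _; rewrite -ltnS prednK ?ltn_mod ?expn_gt0 ?p0.
have -> : `|(- e%:Z + M%:Z - - e%:Z)%R|%N = M by lia.
rewrite {1}vM -[in LHS](@sum_digits (p ^ d) M.+1 M) ?(ltn_trans (ltn_expl M b1)) ?ltn_exp2l//.
rewrite natr_sum mulr_suml; apply: eq_bigr => n _.
have -> : `|(- e%:Z + n%:Z + e%:Z)%R|%N = n by lia.
by rewrite natrM natrX -mulrA exprnP -expfzDr// [n%:Z + _]addrC.
Qed.

End Expansion.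

Theorem theorem4 (R : realType) (p : nat) (p_pr : prime p) (v : R) (d : nat) :
  0 < v -> (0 < d)%N ->
  [/\ (* the balls B_ki are pairwise disjoint *)
      trivIset [set ki : int * nat | (1 <= ki.2 <= (p ^ d).-1)%N]
        (balls_of (padic_center p_pr d)),
      (* (1) *)
      (exists m a, infinite_expansion (p ^ d)%N v m a) /\
      (forall m a, infinite_expansion (p ^ d)%N v m a ->
         let M := padic_manifold p_pr d [set k : int | k <= m] a in
         [/\ open M, ~ compact M & has_padic_volume M v]),
      (* (2) *)
      (exists q : rat, v = ratr q /\ exists e : nat, denq q = (p ^ e)%N%:Z) ->
      (exists l m a, finite_expansion (p ^ d)%N v l m a) /\
      (forall l m a, finite_expansion (p ^ d)%N v l m a ->
         let M := padic_manifold p_pr d [set k : int | l <= k <= m] a in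
         [/\ open M, compact M & has_padic_volume M v])
    & (* symplectic rigidity for d even *)
      ~~ odd d ->
      (forall m a (c : int * nat -> 'rV[padic p_pr]_d),
         infinite_expansion (p ^ d)%N v m a ->
         trivIset (ball_indices [set k : int | k <= m] a) (balls_of c) ->
         symplectomorphic (ball_union c [set k : int | k <= m] a)
           standard_symplectic
           (padic_manifold p_pr d [set k : int | k <= m] a)
           standard_symplectic) /\
      (forall l m a (c : int * nat -> 'rV[padic p_pr]_d),
         finite_expansion (p ^ d)%N v l m a ->
         trivIset (ball_indices [set k : int | l <= k <= m] a) (balls_of c) ->
         symplectomorphic (ball_union c [set k : int | l <= k <= m] a)
           standard_symplectic
           (padic_manifold p_pr d [set k : int | l <= k <= m] a)
           standard_symplectic)].
Proof.
move=> v0 d0.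
have b1 : (1 < p ^ d)%N by rewrite -(expn0 p) ltn_exp2l// prime_gt1.
(* The digit bound keeps the selected indices inside the family already known to be disjoint. *)
have sub (K : set int) a : (forall k, K k -> (a k <= (p ^ d).-1)%N) ->
    trivIset (ball_indices K a) (balls_of (padic_center p_pr d)).
  move=> ab; apply: sub_trivIset (@trivIset_center_balls p p_pr d).
  by move=> [k i] /= [Kk /andP[-> ia]]; rewrite (leq_trans ia)// ab.
split.
- exact: trivIset_center_balls.
- split; first exact: ex_infinite_expansion.
  move=> m a [ab ainf av]; split.
  + exact: open_ball_union.
  + exact: not_compact_infinite_manifold.
  + by move=> mu haar_mu; exact: haar_infinite_manifold.
- move=> vq; split; first exact: ex_finite_expansion.
  move=> l m a [lm ab ->]; split.
  + exact: open_ball_union.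
  + exact: compact_finite_manifold.
  + by move=> mu haar_mu; exact: haar_finite_manifold.
- move=> _; split=> [m a c [ab _ _]|l m a c [_ ab _]] tc.
    by apply: rearrange_symplectomorphic => //; exact: sub.
  by apply: rearrange_symplectomorphic => //; exact: sub.
Qed.
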